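(* Let $\mathcal T=(S,\Sigma,\kappa)$ be a stochastic transition system, $\mathcal B\subseteq\Sigma$ and $\mu\in\mathrm{Dist}(S)$. Then: 1. $\mathcal T$ is strongly decisive w.r.t. $\mathcal B$ from $\mu$ if and only if $\mathcal T$ is persistently decisive w.r.t. $\mathcal B$ from $\mu$; and if these hold then $\mathcal T$ is decisive w.r.t. $\mathcal B$ from $\mu$, and $\mathcal T$ is fair w.r.t. $\mathcal B$ from $\mu$. 2. The three properties ''$\mathcal T$ is decisive w.r.t. $\mathcal B$'', ''$\mathcal T$ is strongly decisive w.r.t. $\mathcal B$'' and ''$\mathcal T$ is persistently decisive w.r.t. $\mathcal B$'' are equivalent, and each implies that $\mathcal T$ is fair w.r.t. $\mathcal B$.
   Context: A stochastic transition system (STS) is $\mathcal T=(S,\Sigma,\kappa)$ where $(S,\Sigma)$ is a measurable space and $\kappa:S\times\Sigma\to[0,1]$ is a Markov kernel. $\mathrm{Dist}(S)$ is the set of probability measures on $(S,\Sigma)$; for $B\in\Sigma$, $\mathrm{Dist}(B)$ is the set of those $\mu$ with $\mu(B)=1$; $\delta_s$ is the Dirac measure at $s$. For $\mu\in\mathrm{Dist}(S)$, $\mathrm{Prob}^{\mathcal T}_\mu$ is the law on infinite paths $s_0s_1s_2\dots\in S^\omega$ (cylinder $\sigma$-algebra) of the Markov chain with initial distribution $\mu$ and kernel $\kappa$. Events, for $B\in\Sigma$ and a path $s_0s_1\dots$: $\mathbf F B$: $\exists i\ge0,\ s_i\in B$; $\mathbf F_{\ge p}B$: $\exists i\ge p,\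 s_i\in B$; $\mathbf G\mathbf F B$: $s_i\in B$ for infinitely many $i$. The avoid-set of $B$ is $\widetilde B=\{s\in S\mid\mathrm{Prob}^{\mathcal T}_{\delta_s}(\mathbf F B)=0\}$ (it belongs to $\Sigma$). For $B\in\Sigma$ and $\mu\in\mathrm{Dist}(S)$, $\mathcal T$ is: - decisive w.r.t. $B$ from $\mu$ if $\mathrm{Prob}^{\mathcal T}_\mu(\mathbf F B\vee\mathbf F\widetilde B)=1$; - strongly decisive w.r.t. $B$ from $\mu$ if $\mathrm{Prob}^{\mathcal T}_\mu(\mathbf G\mathbf F B\vee\mathbf F\widetilde B)=1$; - persistently decisive w.r.t. $B$ from $\mu$ if for every integer $p\ge0$, $\mathrm{Prob}^{\mathcal T}_\mu(\mathbf F_{\ge p}B\vee\mathbf F_{\ge p}\widetilde B)=1$; - fair w.r.t. $B$ from $\mu$ if for every $B'\in\mathrm{PreProb}(B)$ with $\mathrm{Prob}^{\mathcal T}_\mu(\mathbf G\mathbf F B')>0$ one has $\mathrm{Prob}^{\mathcal T}_\mu(\mathbf G\mathbf F B\mid\mathbf G\mathbf F B')=1$, where $\mathrm{PreProb}(B)=\{B'\in\Sigma\mid\forall\mu'\in\mathrm{Dist}(B'),\ \mathrm{Prob}^{\mathcal T}_{\mu'}(s_0\in B',s_1\in B)>0\}$. Each property holds w.r.t. $\mathcal B\subseteq\Sigma$ from $\mu$ if it holds w.r.t. every $B\in\mathcal B$ from $\mu$; it holds w.r.t. $\mathcal B$ (no initial distribution mentioned) if it holds w.r.t. every $B\in\mathcal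 B$ from every $\mu\in\mathrm{Dist}(S)$. *)

(* Defs.v *)
From HB Require Import structures.
From mathcomp Require Import all_boot all_order all_algebra.
From mathcomp Require Import all_classical all_reals all_analysis.
From mathcomp Require Import measurable_realfun lra.

Set Implicit Arguments.
Unset Strict Implicit.
Unset Printing Implicit Defensive.
Import Order.TTheory GRing.Theory Num.Theory.
Import numFieldNormedType.Exports.
Local Open Scope classical_set_scope.
Local Open Scope ring_scope.
Local Open Scope ereal_scope.

(* The path space S^omega; it carries the product sigma-algebra, generated by
   the coordinate maps. *)
Definition paths (S : Type) : Type := nat -> S.

Definition paths_display : measure_display -> measure_display.
Proof. exact. Qed.

HB.instance Definition _ (S : pointedType) := Pointed.on (paths S).

Section path_space.
Context d (S : measurableType d).

Definition coordinate_sets : set (set (paths S)) :=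
  [set C | exists i, exists2 A, measurable A & C = [set w | A (w i)]].

HB.instance Definition _ := @isMeasurable.Build (paths_display d) (paths S)
  <<s coordinate_sets >> (@sigma_algebra0 _ setT coordinate_sets)
  (@sigma_algebraC _ coordinate_sets)
  (@sigma_algebra_bigcup _ setT coordinate_sets).

Lemma measurable_coordinate i : measurable_fun setT (fun w : paths S => w i).
Proof.
move=> _ A mA; rewrite setTI; apply: sub_sigma_algebra.
by exists i, A.
Qed.

Lemma measurable_to_paths d' (T : measurableType d') (f : T -> paths S) :
  (forall i, measurable_fun setT (fun x => f x i)) -> measurable_fun setT f.
Proof.
move=> mf; apply: (@measurability _ _ _ _ _ _ coordinate_sets) => //.
by move=> _ [_ [i [A mA ->]] <-]; exact: mf.
Qed.

End path_space.

Section path_law.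
Context d (S : measurableType d) (R : realType).
Implicit Types (kappa : R.-pker S ~> S) (mu : probability S R).

(* [cylinder_prob kappa A n x] is the iterated integral
     \int_(A 1) kappa(x, dx_1) ... \int_(A n) kappa(x_(n-1), dx_n) 1.  *)
Fixpoint cylinder_prob kappa (A : nat -> set S) (n : nat) (x : S) : \bar R :=
  if n is m.+1 then
    \int[kappa x]_(y in A 1%N) cylinder_prob kappa (fun i => A i.+1) m y
  else 1.

(* Finite-dimensional distributions of the Markov chain with initial
   distribution mu and kernel kappa; they determine P (path_law_unique). *)
Definition is_path_law kappa mu (P : probability (paths S) R) :=
  forall (n : nat) (A : nat -> set S), (forall i, measurable (A i)) ->
  P [set w | forall i, (i <= n)%N -> A i (w i)] =
  \int[mu]_(x in A 0%N) cylinder_prob kappa A n x.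

End path_law.

(* w with its n-th coordinate replaced by y. *)
Local Definition upd (S : Type) (w : paths S) (n : nat) (y : S) : paths S :=
  fun i => if i == n then y else w i.

(* Law of coordinate n given the coordinates below n. *)
Local Definition step_law d (S : measurableType d) (R : realType)
    (kappa : R.-pker S ~> S) (mu : probability S R) (n : nat) (w : paths S) :
    {measure set S -> \bar R} :=
  if n is m.+1 then kappa (w m) else mu.

(* h depends on the first n coordinates only. *)
Local Definition det (S T : Type) (n : nat) (h : paths S -> T) :=
  forall w w', (forall i, (i < n)%N -> w i = w' i) -> h w = h w'.

(* Alias of [paths S] whose measurable sets are the measurable sets that depend
   on finitely many coordinates (an algebra of sets). *)
Local Definition algebra_paths (S : Type) : Type := paths S.

HB.instance Definition _ (S : pointedType) := Pointed.on (algebra_paths S).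

Section finite_dimensional_algebra.
Context d (S : measurableType d).

Let fd : set (set (algebra_paths S)) :=
  [set A : set (paths S) | measurable A /\ exists n, det n A].

Let fd0 : fd set0.
Proof. by split=> //; exists 0%N. Qed.

Let fdU : setU_closed fd.
Proof.
move=> A B [mA [n dA]] [mB [m dB]]; split; first exact: measurableU.
exists (maxn n m) => w w' ww'; rewrite /setU /mkset.
rewrite (dA _ w') => [|i ni]; last by apply: ww'; rewrite leq_max ni.
by rewrite (dB _ w') => [//|i ni]; apply: ww'; rewrite leq_max ni orbT.
Qed.

Let fdC : setC_closed fd.
Proof.
move=> A [mA [n dA]]; split; first exact: measurableC.
by exists n => w w' ww'; rewrite /setC /mkset (dA _ w').
Qed.

HB.instance Definition _ := @isAlgebraOfSets.Build (paths_display d)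
  (algebra_paths S) fd fd0 fdU fdC.

End finite_dimensional_algebra.

(* Ionescu-Tulcea theorem.  J n h integrates out coordinate n of h, conditionally
   on the coordinates below n, and E k m = J k \o ... \o J (k + m - 1).  On the
   algebra of measurable sets that depend on finitely many coordinates, the
   content A |-> E 0 n 1_A (n large enough) is continuous at set0, hence
   sigma-additive, and is extended by Caratheodory's theorem. *)
Section ionescu_tulcea.
Context d (S : measurableType d) (R : realType).
Variables (kappa : R.-pker S ~> S) (mu : probability S R).


Let measurable_upd n :
  measurable_fun setT (fun p : paths S * S => upd p.1 n p.2).
Proof.
apply: measurable_to_paths => i; rewrite /upd.
have [_|_] := eqVneq i n; first exact: measurable_snd.
exact: (measurableT_comp (measurable_coordinate i) measurable_fst).
Qed.

Let measurable_upd1 (w : paths S) n : measurable_fun setT (fun y : S => upd w n y).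
Proof.
apply: measurable_to_paths => i; rewrite /upd.
by have [_|_] := eqVneq i n; [exact: measurable_id|exact: measurable_cst].
Qed.

Let law n := step_law kappa mu n.

Let lawT n w : law n w setT = 1.
Proof. by case: n => [|n] /=; [exact: probability_setT|exact: prob_kernel]. Qed.

Let measurable_law n U : measurable U ->
  measurable_fun setT (fun w : paths S => law n w U).
Proof.
case: n => [|n] mU /=; first exact: measurable_cst.
exact: (measurableT_comp (measurable_kernel kappa U mU)
  (measurable_coordinate n)).
Qed.

HB.instance Definition _ n :=
  isKernel.Build _ _ (paths S) S R (step_law kappa mu n) (@measurable_law n).
HB.instance Definition _ n :=
  Kernel_isProbability.Build _ _ (paths S) S R (step_law kappa mu n) (@lawT n).

Let unitf (h : paths S -> \bar R) :=
  measurable_fun setT h /\ forall w, 0 <= h w <= 1.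

Let J n (h : paths S -> \bar R) w := \int[law n w]_y h (upd w n y).

Let mupd n w h : unitf h -> measurable_fun setT (fun y => h (upd w n y)).
Proof. by move=> [mh _]; exact: measurableT_comp. Qed.

Let u0 h w : unitf h -> 0 <= h w.
Proof. by case=> _ /(_ w)/andP[]. Qed.

Let u1 h w : unitf h -> h w <= 1.
Proof. by case=> _ /(_ w)/andP[]. Qed.

Let J_le n h g : unitf h -> unitf g -> (forall w, h w <= g w) ->
  forall w, J n h w <= J n g w.
Proof.
move=> uh ug hg w; apply: ge0_le_integral => //;
  by [move=> y _; exact: u0|exact: mupd].
Qed.

Let J_add n h g w : unitf h -> unitf g ->
  J n (fun w => h w + g w) w = J n h w + J n g w.
Proof.
move=> uh ug; apply: ge0_integralD => //;
  by [move=> y _; exact: u0|exact: mupd].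
Qed.

Let unitf_cst1 : unitf (cst 1).
Proof. by split=> [|w]; [exact: measurable_cst|rewrite /= lee01 lexx]. Qed.

Let J_cst1 n w : J n (cst 1) w = 1.
Proof. by rewrite /J integral_cst//= lawT mule1. Qed.

Let J_unit n h : unitf h -> unitf (J n h).
Proof.
move=> uh; have [mh h01] := uh; split.
  have := @measurable_fun_integral_finite_kernel _ _ (paths S) S R
    (fun p => h (upd p.1 n p.2)) (law n : R.-pker paths S ~> S).
  apply; first by move=> z; exact: u0.
  exact: measurableT_comp.
move=> w; apply/andP; split.
  by apply: integral_ge0 => y _; exact: u0.
by rewrite -(J_cst1 n w) J_le// => w'; exact: u1.
Qed.

Let J_cvg n (h : nat -> paths S -> \bar R) g w : (forall j, unitf (h j)) ->
  (forall w, h ^~ w @ \oo --> g w) -> (fun j => J n (h j) w) @ \oo --> J n g w.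
Proof.
move=> uh hg; apply: (@dominated_cvg _ _ _ _ _ measurableT
  (fun j y => h j (upd w n y)) (fun y => g (upd w n y)) (cst 1)) => //.
- by move=> j; exact: mupd.
- apply/integrableP; split; first exact: measurable_cst.
  under eq_integral do rewrite /= normr1.
  by have := J_cst1 n w; rewrite /J => ->; rewrite ltry.
- move=> j y _; have /andP[h0 h1] := (uh j).2 (upd w n y).
  by rewrite gee0_abs.
Qed.

Let det_le T n m (h : paths S -> T) : (n <= m)%N -> det n h -> det m h.
Proof.
by move=> nm dh w w' ww'; apply: dh => i ni; apply: ww'; exact: leq_trans nm.
Qed.

Let J_id n h w : det n h -> J n h w = h w.
Proof.
move=> dh; rewrite /J (eq_integral (cst (h w))); last first.
  by move=> y _; apply: dh => i ni; rewrite /upd ltn_eqF.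
by rewrite integral_cst// lawT mule1.
Qed.

Let det_J n h : det n.+1 h -> det n (J n h).
Proof.
move=> dh w w' ww'; rewrite /J.
have -> : law n w = law n w' by case: n dh ww' => //= n _ ->.
apply: eq_integral => y _; apply: dh => i; rewrite ltnS leq_eqVlt /upd.
by case: eqVneq => //= _; exact: ww'.
Qed.

Local Fixpoint E k m (h : paths S -> \bar R) {struct m} : paths S -> \bar R :=
  if m is m'.+1 then J k (E k.+1 m' h) else h.

Let ES k m h : E k m.+1 h = J k (E k.+1 m h). Proof. by []. Qed.

Let E_unit k m h : unitf h -> unitf (E k m h).
Proof. by elim: m k => //= m IH k uh; apply: J_unit; exact: IH. Qed.

Let E_le k m h g : unitf h -> unitf g -> (forall w, h w <= g w) ->
  forall w, E k m h w <= E k m g w.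
Proof.
move=> uh ug hg; elim: m k => //= m IH k w.
by apply: J_le => //; exact: E_unit.
Qed.

Let E_add k m h g w : unitf h -> unitf g ->
  E k m (fun w => h w + g w) w = E k m h w + E k m g w.
Proof.
move=> uh ug; elim: m k w => //= m IH k w.
rewrite -J_add; [|exact: E_unit|exact: E_unit].
by congr J; apply/funext => w'; exact: IH.
Qed.

Let E_det k m h : det (k + m) h -> det k (E k m h).
Proof.
elim: m k => [|m IH] k; first by rewrite addn0.
by rewrite addnS -addSn => /IH /det_J.
Qed.

Let E_stable1 k m h w : det (k + m) h -> E k m.+1 h w = E k m h w.
Proof.
elim: m k w => [|m IH] k w.
  by rewrite addn0 => dh /=; exact: J_id.
rewrite addnS -addSn => dh; rewrite !ES.
by congr J; apply/funext => w'; exact: IH.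
Qed.

Let E_stable k m m' h : det (k + m) h -> (m <= m')%N -> E k m' h = E k m h.
Proof.
move=> dh mm'; rewrite -(subnKC mm'); elim: (m' - m)%N => [|p IH].
  by rewrite addn0.
rewrite addnS -IH; apply/funext => w; apply: E_stable1.
by apply: det_le dh; rewrite leq_add2l leq_addr.
Qed.

Let ind (A : set (paths S)) (w : paths S) : \bar R := (\1_A w)%:E.

Let ind_unit A : measurable A -> unitf (ind A).
Proof.
move=> mA; split; first exact/measurable_EFinP/measurable_indic.
by move=> w; rewrite /ind indicE !lee_fin ler0n lern1 leq_b1.
Qed.

Let ind_det n (A : set (paths S)) : det n A -> det n (ind A).
Proof.
by move=> dA w w' /dA ww'; rewrite /ind !indicE /in_mem /= /in_set ww'.
Qed.

Let E_ind_stable k m m' n A : det n A -> (n <= k + m)%N -> (n <= k + m')%N ->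
  E k m (ind A) = E k m' (ind A).
Proof.
wlog mm' : m m' / (m <= m')%N => [wlg dA nm nm'|dA nm nm'].
  by have [?|/ltnW ?] := leqP m m'; [|apply/esym]; exact: wlg.
by apply/esym/E_stable => //; apply: ind_det; exact: det_le dA.
Qed.

Let content_cvg0 (A : nat -> set (paths S)) (dep : nat -> nat) w0 :
  (forall j, measurable (A j)) -> (forall j, det (dep j) (A j)) ->
  (forall j, A j.+1 `<=` A j) -> \bigcap_j A j = set0 ->
  (fun j => E 0 (dep j) (ind (A j)) w0) @ \oo --> 0.
Proof.
move=> mA dA Adec A0.
pose f k j := E k (dep j - k) (ind (A j)).
have uf k j : unitf (f k j) by apply: E_unit; exact: ind_unit.
have fJ k j : f k j = J k (f k.+1 j).
  rewrite /f -ES; apply: (@E_ind_stable _ _ _ (dep j)) => //.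
    by rewrite -leq_subLR.
  by rewrite addnS -addSn -leq_subLR.
have fdet k j : det k (f k j).
  apply: E_det; apply: ind_det; apply: det_le (dA j).
  by rewrite -leq_subLR.
have fdec k w : nonincreasing_seq (fun j => f k j w).
  apply/nonincreasing_seqP => j; rewrite /f.
  pose M := maxn (dep j) (dep j.+1).
  rewrite (@E_ind_stable _ (dep j - k) M (dep j))//; first last.
  - by rewrite (leq_trans _ (leq_addl _ _))// leq_maxl.
  - by rewrite -leq_subLR.
  rewrite (@E_ind_stable _ (dep j.+1 - k) M (dep j.+1))//; first last.
  - by rewrite (leq_trans _ (leq_addl _ _))// leq_maxr.
  - by rewrite -leq_subLR.
  apply: E_le; [exact: ind_unit|exact: ind_unit|move=> w'].
  rewrite /ind lee_fin !indicE ler_nat.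
  by case: (boolP (w' \in A j.+1)) => // /set_mem/Adec/mem_set ->.
pose F k w := ereal_inf (range (fun j => f k j w)).
have fF k w : (fun j => f k j w) @ \oo --> F k w.
  exact: ereal_nonincreasing_cvgn.
have FJ k w : F k w = J k (F k.+1) w.
  apply: (cvg_unique _ (fF k w)) => //.
  rewrite (_ : (fun j => f k j w) = (fun j => J k (f k.+1 j) w)).
    by apply: J_cvg => // w'; exact: fF.
  by apply/funext => j; rewrite fJ.
have F_ge0 k w : 0 <= F k w.
  by apply: le_ereal_inf_tmp => _ [j _ <-]; exact: u0.
have Fdet k : det k (F k).
  move=> w w' ww'; rewrite /F.
  suff -> : (fun j => f k j w) = (fun j => f k j w') by [].
  by apply/funext => j; exact: fdet.
suff F00 : F 0%N w0 = 0.
  rewrite -F00; rewrite (_ : (fun j => _) = (fun j => f 0%N j w0))//.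
  by apply/funext => j; rewrite /f subn0.
apply: contrapT => /eqP F0.
have {}F0 : 0 < F 0%N w0 by rewrite lt0e F0 F_ge0.
have /choice[y yP] : forall k, exists y : paths S -> S, forall w,
    0 < F k w -> 0 < F k.+1 (upd w k (y w)).
  move=> k.
  suff /choice[y yP] : forall w : paths S, exists y : S,
      0 < F k w -> 0 < F k.+1 (upd w k y) by exists y.
  move=> w; apply: contrapT => /forallNP H.
  have /not_implyP[Fw _] := H point.
  move: Fw; rewrite FJ /J integral0_eq ?ltxx// => z _.
  have /not_implyP[_ /negP] := H z.
  by rewrite lt0e F_ge0 andbT negbK => /eqP.
pose ws := fix ws k := if k is k'.+1 then upd (ws k') k' (y k' (ws k')) else w0.
have Fws k : 0 < F k (ws k) by elim: k => //= k; exact: yP.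
pose w i := ws i.+1 i.
have wsE k i : (i < k)%N -> ws k i = w i.
  elim: k => // k IH; rewrite ltnS leq_eqVlt => /predU1P[->//|ik].
  by rewrite /= /upd ltn_eqF// IH.
suff : (\bigcap_j A j) w by rewrite A0.
move=> j _.
have : 0 < f (dep j) j w.
  apply: (@lt_le_trans _ _ (F (dep j) w)).
    by rewrite (Fdet _ _ (ws (dep j)))// => i /wsE.
  by apply: ereal_inf_lbound; exists j.
rewrite /f subnn /= /ind lte_fin indicE.
by case: (boolP (w \in A j)) => [/set_mem//|_]; rewrite ltxx.
Qed.


Let depth (A : set (paths S)) : nat := xget 0%N [set n | det n A].

Let depthP n A : det n A -> det (depth A) A.
Proof. by move=> dA; rewrite /depth; case: xgetP => // /(_ n)/(_ dA). Qed.

Let content (A : set (algebra_paths S)) : \bar R :=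
  E 0 (depth A) (ind A) point.

Let contentE n (A : set (paths S)) : det n A ->
  content A = E 0 n (ind A) point.
Proof.
move=> dA; rewrite /content (@E_ind_stable _ (depth A) (maxn (depth A) n) (depth A))//.
- by apply/esym; rewrite (@E_ind_stable _ n (maxn (depth A) n) n)// leq_maxr.
- exact: depthP dA.
- exact: leq_maxl.
Qed.

Let content0 : content set0 = 0.
Proof.
by rewrite (@contentE 0%N)//= /ind indic0.
Qed.

Let content_ge0 A : 0 <= content A.
Proof.
rewrite /content; elim: (depth A) 0%N point => [|m IH] k w /=.
  by rewrite /ind lee_fin.
by apply: integral_ge0 => y _; exact: IH.
Qed.

Let content_le1 (A : set (algebra_paths S)) : measurable A -> content A <= 1.
Proof. by move=> [mA _]; apply: u1; apply: E_unit; exact: ind_unit. Qed.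

Let contentD (A B : set (algebra_paths S)) :
  measurable A -> measurable B -> B `<=` A ->
  content A = content B + content (A `\` B).
Proof.
move=> mA mB BA; have mAB : measurable (A `\` B) by exact: measurableD.
have [sA [n dA]] := mA; have [sB [m dB]] := mB; have [sD _] := mAB.
pose N := maxn n m.
have dA' : det N A by apply: det_le dA; exact: leq_maxl.
have dB' : det N B by apply: det_le dB; exact: leq_maxr.
have dD' : det N (A `\` B).
  by move=> w w' ww'; rewrite /setD /mkset (dA' _ w')// (dB' _ w').
rewrite !(@contentE N)// -E_add; [|exact: ind_unit|exact: ind_unit].
suff -> : ind A = (fun w => ind B w + ind (A `\` B) w) by [].
apply/funext => w; rewrite /ind -EFinD !indicE in_setD.
have [wB|wB] := boolP (w \in B); last by rewrite andbT add0r.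
by rewrite andbF addr0 (mem_set (BA _ (set_mem wB))).
Qed.

Let content_sigma_additive : semi_sigma_additive content.
Proof.
move=> F mF tF mUF.
pose T := fix T n := if n is m.+1 then T m `\` F m else \bigcup_i F i.
have mT n : measurable (T n) by elim: n => //= n IH; exact: measurableD.
have FT n m : (n <= m)%N -> F m `<=` T n.
  elim: n => [_|n IH nm] w Fw /=; first by exists m.
  split; first by apply: IH Fw; exact: ltnW.
  move=> Fnw; have : n = m by apply: tF => //; exists w.
  by move=> nmE; move: nm; rewrite nmE ltnn.
have TD n : content (T n) = content (F n) + content (T n.+1).
  by apply: contentD => //; exact: FT.
have fin A : measurable A -> content A \is a fin_num.
  move=> mA; rewrite ge0_fin_numE//.
  by rewrite (le_lt_trans (content_le1 mA))// ltry.
have sumE n : \sum_(0 <= i < n) content (F i) =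
    content (\bigcup_i F i) - content (T n).
  elim: n => [|n IH]; first by rewrite big_geq// subee// fin.
  rewrite big_nat_recr//= IH (TD n); move: (fin _ (mF n)) (fin _ (mT n.+1)).
  move=> /fineK <- /fineK <-; rewrite -(fineK (fin _ mUF)) -!EFinD; congr EFin; lra.
rewrite [X in X @ _](_ : _ = (fun n => content (\bigcup_i F i) - content (T n))).
  rewrite -[X in _ --> X]sube0; apply: cvgeB.
  - by apply: fin_num_adde_defr; rewrite ?fin_numN ?fin.
  - exact: cvg_cst.
  have dT n : {m | det m (T n)} by apply: cid; have [] := mT n.
  rewrite (_ : (fun n => _) =
    (fun n => E 0 (projT1 (dT n)) (ind (T n)) point)); last first.
    by apply/funext => n; apply: contentE; exact: (projT2 (dT n)).
  apply: content_cvg0.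
  - by move=> n; have [] := mT n.
  - by move=> n; exact: (projT2 (dT n)).
  - by move=> n; exact: subDsetl.
  - rewrite -subset0 => w Tw; have [i _ Fi] := Tw 0%N Logic.I.
    by have [] := Tw i.+1 Logic.I.
by apply/funext => n; exact: sumE.
Qed.

HB.instance Definition _ := isMeasure.Build _ _ _ content
  content0 content_ge0 content_sigma_additive.

Let ext (A : set (paths S)) : \bar R :=
  measure_extension (content : {measure set (algebra_paths S) -> \bar R}) A.

Let ext_measurable (A : set (paths S)) : measurable A ->
  measurable (A : set (g_sigma_algebraType (@measurable _ (algebra_paths S)))).
Proof.
apply: smallest_sub; first exact: smallest_sigma_algebra.
move=> _ [i [B mB ->]]; apply: sub_sigma_algebra; split.
  by apply: sub_sigma_algebra; exists i, B.
by exists i.+1 => w w' ww'; rewrite /mkset ww'.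
Qed.

Let ext0 : ext set0 = 0. Proof. exact: measure0. Qed.

Let ext_ge0 A : 0 <= ext A. Proof. exact: measure_ge0. Qed.

Let ext_sigma_additive : semi_sigma_additive ext.
Proof.
move=> F mF tF mUF; apply: measure_semi_sigma_additive => //.
  by move=> i; exact: ext_measurable.
exact: ext_measurable.
Qed.

HB.instance Definition _ := isMeasure.Build _ _ _ ext
  ext0 ext_ge0 ext_sigma_additive.

Let extE n (A : set (paths S)) : measurable A -> det n A ->
  ext A = E 0 n (ind A) point.
Proof.
move=> mA dA; rewrite /ext /measure_extension measurable_mu_extE//=.
  exact: contentE.
by split=> //; exists n.
Qed.

Let extT : ext setT = 1.
Proof. by rewrite (@extE 0%N)//= /ind indicT. Qed.

HB.instance Definition _ := Measure_isProbability.Build _ _ _ ext extT.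

Let cyl (A : nat -> set S) n : set (paths S) :=
  [set w | forall i, (i <= n)%N -> A i (w i)].

Let cyl_det A n : det n.+1 (cyl A n).
Proof.
move=> w w' ww'; apply/propext; split=> H i ni; first by rewrite -ww'//; exact: H.
by rewrite ww'//; exact: H.
Qed.

Lemma measurable_cylinder A n :
  (forall i, measurable (A i)) -> measurable (cyl A n).
Proof.
move=> mA; rewrite (_ : cyl A n =
    \bigcap_(i in [set i | (i <= n)%N]) (fun w => w i) @^-1` A i).
  apply: bigcap_measurable => [|i _]; first by exists 0%N.
  by rewrite -[X in measurable X]setTI; exact: measurable_coordinate.
by apply/seteqP; split.
Qed.

Let E_cyl A n k w : E k.+1 n (ind (cyl A (k + n))) w =
  ind (cyl A k) w * cylinder_prob kappa (fun i => A (k + i)%N) n (w k).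
Proof.
elim: n A k w => [|n IH] A k w; first by rewrite addn0 mule1.
rewrite addnS -addSn ES /J /law /=.
rewrite (eq_integral (fun y => ind (cyl A k) w *
    ((fun y => cylinder_prob kappa (fun i => A (k + i.+1)%N) n y)
      \_ (A (k + 1)%N)) y)); last first.
  move=> y _; rewrite IH /upd eqxx patchE.
  have -> : (fun i => A (k.+1 + i)%N) = (fun i => A (k + i.+1)%N).
    by apply/funext => i; rewrite addSnnS.
  have -> : ind (cyl A k.+1) (upd w k.+1 y) =
      ind (cyl A k) w * (\1_(A (k + 1)%N) y)%:E.
    rewrite /ind -EFinM !indicE -natrM mulnb; congr (_%:R%:E).
    congr nat_of_bool; apply/idP/andP => [/set_mem H|[/set_mem H /set_mem Ay]].
      split; apply/mem_set; last first.
        by have := H k.+1 (leqnn _); rewrite /upd eqxx addn1.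
      move=> i ik; have := H i (leqW ik).
      by rewrite /upd ltn_eqF.
    apply/mem_set => i; rewrite leq_eqVlt /upd.
    by case: eqVneq => [->|_] /=; [rewrite -addn1|exact: H].
  rewrite -muleA indicE; congr (_ * _).
  by case: ifP => _; rewrite ?mul1e ?mul0e.
rewrite /ind indicE; case: (w \in cyl A k).
  rewrite mul1e [RHS]integral_mkcond; apply: eq_integral => y _.
  by rewrite mul1e.
by rewrite mul0e integral0_eq// => y _; rewrite mul0e.
Qed.

Lemma path_law_exists :
  exists P : probability (paths S) R, is_path_law kappa mu P.
Proof.
exists (ext : probability (paths S) R) => n A mA.
rewrite [LHS](@extE n.+1); [|exact: measurable_cylinder|exact: cyl_det].
rewrite ES /J /law /= [RHS]integral_mkcond; apply: eq_integral => y _.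
have := @E_cyl A n 0 (upd point 0 y); rewrite add0n => ->.
rewrite patchE /ind indicE /upd /=.
have -> : (upd point 0 y \in cyl A 0) = (y \in A 0%N).
  apply/idP/idP => /set_mem H; apply/mem_set; first exact: (H 0%N).
  by move=> i; rewrite leqn0 => /eqP ->.
by case: ifP => _; rewrite ?mul1e ?mul0e.
Qed.

Lemma path_law_unique (P Q : probability (paths S) R) :
  is_path_law kappa mu P -> is_path_law kappa mu Q ->
  forall A, measurable A -> P A = Q A.
Proof.
move=> HP HQ; pose G := [set C | exists n (A : nat -> set S),
  (forall i, measurable (A i)) /\ C = cyl A n].
have mG : @measurable _ (paths S) = <<s G >>.
  apply/seteqP; split.
    apply: smallest_sub; first exact: smallest_sigma_algebra.
    move=> _ [i [B mB ->]]; apply: sub_sigma_algebra.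
    exists i, (fun j => if j == i then B else setT); split=> [j|].
      by case: ifP.
    apply/seteqP; split=> w /= => [Bw j _|/(_ i (leqnn _))]; last by rewrite eqxx.
    by case: eqVneq => // ->.
  apply: smallest_sub; first exact: sigma_algebra_measurable.
  by move=> _ [n [A [mA ->]]]; exact: measurable_cylinder.
have GI : setI_closed G.
  move=> _ _ [n [A [mA ->]]] [m [B [mB ->]]].
  exists (maxn n m), (fun i => (if (i <= n)%N then A i else setT) `&`
    (if (i <= m)%N then B i else setT)); split=> [i|].
    by apply: measurableI; case: ifP.
  apply/seteqP; split=> w /=.
    by move=> [HA HB] i _; split; case: ifP => // ?; [exact: HA|exact: HB].
  move=> H; split=> i ni; have := H i; rewrite leq_max ni ?orbT => /(_ isT) [].
    by [].
  by [].
have GT : G setT.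
  exists 0%N, (fun=> setT); split=> //.
  by apply/seteqP; split.
apply: (measure_unique G (fun=> setT)) => //.
- by apply/seteqP; split=> // w _; exists 0%N.
- by move=> _ [n [A [mA ->]]]; rewrite [LHS]HP// [RHS]HQ.
- by move=> _; rewrite (le_lt_trans (probability_le1 P measurableT))// ltry.
Qed.

End ionescu_tulcea.

Section decisiveness.
Context d (S : measurableType d) (R : realType).
Variable kappa : R.-pker S ~> S.
Implicit Types (B : set S) (BB : set (set S)) (mu : probability S R).

(* The law Prob_mu of the chain; characterized by path_lawP, path_law_unique. *)
Definition path_law mu : probability (paths S) R :=
  projT1 (cid (path_law_exists kappa mu)).

Lemma path_lawP mu : is_path_law kappa mu (path_law mu).
Proof. exact: (projT2 (cid (path_law_exists kappa mu))). Qed.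

Definition eventually B : set (paths S) := [set w | exists i, B (w i)].

Definition eventually_from (p : nat) B : set (paths S) :=
  [set w | exists2 i, (p <= i)%N & B (w i)].

Definition infinitely_often B : set (paths S) :=
  [set w | infinite_set [set i | B (w i)]].

Definition avoid_set B : set S :=
  [set s | path_law (dirac s) (eventually B) = 0].

Definition decisive_from B mu : Prop :=
  path_law mu (eventually B `|` eventually (avoid_set B)) = 1.

Definition strongly_decisive_from B mu : Prop :=
  path_law mu (infinitely_often B `|` eventually (avoid_set B)) = 1.

Definition persistently_decisive_from B mu : Prop :=
  forall p : nat,
  path_law mu (eventually_from p B `|` eventually_from p (avoid_set B)) = 1.

Definition pre_prob B : set (set S) :=
  [set B' | measurable B' /\
    forall mu' : probability S R, mu' B' = 1 ->
      0 < path_law mu' [set w | B' (w 0%N) /\ B (w 1%N)]].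

Definition cond_prob (P : probability (paths S) R) (A C : set (paths S)) : R :=
  (fine (P (A `&` C)) / fine (P C))%R.

Definition fair_from B mu : Prop :=
  forall B', pre_prob B B' -> 0 < path_law mu (infinitely_often B') ->
    cond_prob (path_law mu) (infinitely_often B) (infinitely_often B') = 1%R.

(* [prop] is one of the four properties above, each a property of a single
   target set and initial distribution. *)
Definition wrt_from (prop : set S -> probability S R -> Prop) BB mu : Prop :=
  forall B, BB B -> prop B mu.

Definition wrt (prop : set S -> probability S R -> Prop) BB : Prop :=
  forall B, BB B -> forall mu, prop B mu.

End decisiveness.

(* Main.v *)
From HB Require Import structures.
Require Import Defs.
From mathcomp Require Import all_boot all_order all_algebra.
From mathcomp Require Import all_classical all_reals all_analysis.
From mathcomp Require Import measurable_realfun.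
Local Open Scope classical_set_scope.

Set Implicit Arguments.
Unset Strict Implicit.
Unset Printing Implicit Defensive.
Import Order.TTheory GRing.Theory Num.Theory.
Local Open Scope ring_scope.
Local Open Scope ereal_scope.

(* Write N for the avoid-set of B and q_n(x) for the probability that the chain
   started at x avoids B up to time n.  Since x is in N iff x is not in B and
   q_n(x) = 1 for all n, and since q_(n+1)(x) is the integral of q_n over ~B
   against kappa(x, .), every x in N satisfies kappa(x, ~N) = 0: almost surely,
   a path that enters N stays there.  Hence, up to null sets, "F N" is
   "F_(>=p) N" for every p, which gives strong => persistent; conversely the
   intersection over p of the persistent events is contained in
   "G F B or F N".  For fairness, a Dirac mass at a point of B' and N would
   contradict B' in PreProb(B), so B' and N are disjoint; as N is absorbing,
   a.s. no path visits B' infinitely often after entering N.  Finally, by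
   the Markov property, the persistent event for p under mu has the probability
   of the decisive event under the law of the p-th state. *)

(** * Events of probability one and their null complements *)

Section probability_one.
Context d (T : measurableType d) (R : realType).
Implicit Types (A : set T).

Let sub1e_eq0 (x : \bar R) : 1 - x = 0 -> x = 1.
Proof.
by case: x => [r| |]//=; rewrite -EFinB => -[] /eqP; rewrite subr_eq0 => /eqP <-.
Qed.

Lemma probability1P (P : probability T R) A : measurable A ->
  P A = 1 <-> P.-negligible (~` A).
Proof.
move=> mA; have mCA := measurableC mA.
have PC : P (~` A) = 1 - P A by exact: probability_setC.
split=> [P1|/(measure_negligible mCA) PCA0].
  by apply/(negligibleP _ mCA); rewrite [LHS]PC P1 subee.
by apply: sub1e_eq0; rewrite -PC.
Qed.

(** The function [1 - f] is nonnegative with integral 0, hence vanishes almost everywhere. *)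
Lemma integral1_negligible (m : {measure set T -> \bar R}) (f : T -> \bar R) :
  m setT = 1 -> measurable_fun setT f -> (forall x, 0 <= f x <= 1) ->
  \int[m]_x f x = 1 -> m.-negligible [set x | f x != 1].
Proof.
move=> m1 mf f01 If.
have f0 x : 0 <= f x by have /andP[] := f01 x.
have ffin x : f x \is a fin_num.
  rewrite ge0_fin_numE//; have /andP[_ /le_lt_trans] := f01 x; apply.
  by rewrite ltry.
pose g x := 1 - f x.
have g0 x : 0 <= g x.
  by have /andP[_] := f01 x; rewrite -sube_ge0 ?ffin.
have mg : measurable_fun setT g.
  by apply: emeasurable_funB => //; exact: measurable_cst.
have Ig : \int[m]_x g x = 0.
  have : \int[m]_x (f x + g x) = 1.
    rewrite (eq_integral (cst 1)) => [|x _]; last by rewrite /g addeC subeK.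
    by rewrite integral_cst// m1 mule1.
  rewrite ge0_integralD// If => /(congr1 (fun y => y - 1)).
  by rewrite addeAC subee// add0e.
have /ae_eq_integral_abs : \int[m]_x `|g x| = 0.
  by rewrite -Ig; apply: eq_integral => x _; rewrite gee0_abs.
move=> /(_ measurableT mg); apply: negligibleS => x /eqP fx1 H.
by apply/fx1/sub1e_eq0; exact: H.
Qed.

End probability_one.

(** * Bounds, measurability and vanishing of the iterated integrals *)

Section cylinder_prob.
Context d (S : measurableType d) (R : realType) (kappa : R.-pker S ~> S).
Implicit Types (A : nat -> set S) (mu : probability S R).

Lemma cylinder_prob_ge0 A n x : 0 <= cylinder_prob kappa A n x.
Proof.
by elim: n A x => [|n IH] A x /=; [exact: lee01|exact: integral_ge0].
Qed.

Lemma measurable_cylinder_prob A n : (forall i, measurable (A i)) ->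
  measurable_fun setT (cylinder_prob kappa A n).
Proof.
elim: n A => [|n IH] A mA /=; first exact: measurable_cst.
under eq_fun do rewrite integral_mkcond.
apply: measurable_fun_integral_kernel.
- by move=> U mU; exact: measurable_kernel.
- by move=> y; rewrite erestrict_ge0// => z _; exact: cylinder_prob_ge0.
- by apply/(measurable_restrictT _ _).1 => //; apply: measurable_funTS; exact: IH.
Qed.

Lemma cylinder_prob_le1 A n x : (forall i, measurable (A i)) ->
  cylinder_prob kappa A n x <= 1.
Proof.
elim: n A x => [|n IH] A x mA //=.
apply: (@le_trans _ _ (\int[kappa x]_(y in A 1%N) 1)).
  apply: ge0_le_integral => //.
  - by move=> y _; exact: cylinder_prob_ge0.
  - by apply: measurable_funTS; exact: measurable_cylinder_prob.
  - by move=> y _; exact: IH.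
rewrite integral_cst// mul1e -(@prob_kernel _ _ _ _ _ kappa x).
by apply: le_measure; rewrite ?inE.
Qed.

(** The innermost integral runs over [A n.+1], a null set for the kernel from every point of [A n].
    Induction peels off the outer integrals; the domain of each one supplies the condition on the
    starting point of the next. *)
Lemma cylinder_prob_eq0 A n x : (forall i, measurable (A i)) ->
  (forall y, A n y -> kappa y (A n.+1) = 0) -> A 0%N x ->
  cylinder_prob kappa A n.+1 x = 0.
Proof.
elim: n A x => [|n IH] A x mA H Ax.
  by rewrite /= integral_cst// mul1e H.
rewrite [LHS]integral0_eq// => y Ay.
exact: (IH (fun i => A i.+1)).
Qed.

End cylinder_prob.

(** * Measurability and absorption of the avoid-set *)

Section avoid_set.
Context d (S : measurableType d) (R : realType) (kappa : R.-pker S ~> S).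
Implicit Types (B : set S) (mu : probability S R).

Lemma measurable_coordinate_set B i : measurable B ->
  measurable [set w : paths S | B (w i)].
Proof.
by move=> mB; rewrite -[X in measurable X]setTI; exact: measurable_coordinate.
Qed.

Lemma measurable_eventually_from p B : measurable B ->
  measurable (eventually_from p B).
Proof.
move=> mB.
rewrite (_ : eventually_from p B =
    \bigcup_(i in [set i | (p <= i)%N]) [set w | B (w i)]).
  by apply: bigcup_measurable => i _; exact: measurable_coordinate_set.
by apply/seteqP; split=> w [i]; exists i.
Qed.

Lemma eventually_from0 B : eventually_from 0 B = Defs.eventually B.
Proof. by apply/seteqP; split=> w [i] => [_|] Bi; exists i. Qed.

Lemma measurable_eventually B : measurable B -> measurable (Defs.eventually B).
Proof. by rewrite -eventually_from0; exact: measurable_eventually_from. Qed.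

Lemma infinitely_oftenE B :
  infinitely_often B = \bigcap_p eventually_from p B.
Proof.
apply/seteqP; split=> w /= H.
  move=> p _; apply: contrapT => Hp; apply: H.
  apply: (@sub_finite_set _ _ `I_p) => //= i Bi; rewrite /= ltnNge; apply/negP => pi.
  by apply: Hp; exists i.
move=> /finite_seqP[s Bs].
(* If [s] lists all visit times, a visit strictly after their maximum is a contradiction. *)
have [i si Bi] := H (\max_(i <- s) i).+1 Logic.I.
have : [set` s] i by rewrite -Bs.
by move=> /= /leq_bigmax_seq -/(_ (fun=> true) id isT); rewrite leqNgt si.
Qed.

(** The complement of F B is the intersection over n of the cylinders avoiding [B] up to time n, so
    it has probability 1 iff each of them has. [cylinder_prob] leaves time 0 unconstrained, hence
    the separate condition [~ B x]. *)
Lemma avoid_setP B x : measurable B ->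
  avoid_set kappa B x <->
  ~ B x /\ forall n, cylinder_prob kappa (fun=> ~` B) n x = 1.
Proof.
move=> mB; have mCB : measurable (~` B) by exact: measurableC.
have cylE n : path_law kappa (dirac x)
      [set w | forall i, (i <= n)%N -> (~` B) (w i)] =
    \d_x (~` B) * cylinder_prob kappa (fun=> ~` B) n x.
  rewrite (path_lawP kappa (dirac x) _ (A := fun=> ~` B))// integral_dirac//.
  by apply: measurable_funTS; exact: measurable_cylinder_prob.
have mcyl n : measurable [set w : paths S | forall i, (i <= n)%N -> (~` B) (w i)].
  exact: (@measurable_cylinder _ _ (fun=> ~` B)).
rewrite /avoid_set /=.
transitivity (forall n, path_law kappa (dirac x)
    [set w | forall i, (i <= n)%N -> (~` B) (w i)] = 1).
  split=> [FB0 n|H].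
    apply/probability1P => //.
    have /(negligibleP _ (measurable_eventually mB)) := FB0.
    apply: negligibleS => w /existsNP[i /not_implyP[_ /contrapT Bi]].
    by exists i.
  apply: measure_negligible; first exact: measurable_eventually.
  have /negligible_bigcup : forall n, (path_law kappa (dirac x)).-negligible
      (~` [set w | forall i, (i <= n)%N -> (~` B) (w i)]).
    by move=> n; apply/probability1P.
  by apply: negligibleS => w [i Bi]; exists i => // /(_ _ (leqnn i)).
split=> [H|[Bx H] n]; last by rewrite cylE diracE mem_set// mul1e.
have Bx : ~ B x.
  move=> Bx; have := H 0%N; rewrite cylE diracE.
  have /negbTE-> : x \notin ~` B by rewrite in_setC negbK; exact/mem_set.
  by rewrite mul0e => /esym/eqP; rewrite onee_eq0.
by split=> // n; rewrite -(H n) cylE diracE mem_set// mul1e.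
Qed.

Lemma avoid_setE B : measurable B ->
  avoid_set kappa B =
  ~` B `&` \bigcap_n [set x | cylinder_prob kappa (fun=> ~` B) n x = 1].
Proof.
move=> mB; apply/seteqP; split=> x; rewrite avoid_setP//.
  by move=> [Bx H]; split=> // n _; exact: H.
by move=> [Bx H]; split=> // n; exact: H.
Qed.

Lemma measurable_avoid_set B : measurable B -> measurable (avoid_set kappa B).
Proof.
move=> mB; have mCB : measurable (~` B) by exact: measurableC.
rewrite avoid_setE//; apply: measurableI => //.
apply: bigcap_measurable => [|n _]; first by exists 0%N.
rewrite (_ : [set x | _] = ~` (setT `&` [set x |
    cylinder_prob kappa (fun=> ~` B) n x != 1])).
  by apply/measurableC/emeasurable_neq => //; exact: measurable_cylinder_prob.
by rewrite setTI; apply/seteqP; split=> x /= => [->|/negP/negPn/eqP//]; rewrite eqxx.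
Qed.

Lemma kernel_avoid_setC B x : measurable B -> avoid_set kappa B x ->
  kappa x (~` avoid_set kappa B) = 0.
Proof.
move=> mB /(avoid_setP x mB)[_ H].
have mCB : measurable (~` B) by exact: measurableC.
apply: measure_negligible; first exact/measurableC/measurable_avoid_set.
(* This is q_n set to 0 on [B]: a point lies in the avoid-set iff [f n] is 1 there for all n, and
   the integral of [f n] against [kappa x] is q_(n+1)(x) = 1. *)
pose f n := cylinder_prob kappa (fun=> ~` B) n \_ (~` B).
suff : forall n, (kappa x).-negligible [set y | f n y != 1].
  move/negligible_bigcup; apply: negligibleS.
  rewrite avoid_setE// setCI setCK setC_bigcap => y [By|[n _ /= /eqP Hy]].
    exists 0%N => //=; rewrite /f patchE.
    have /negbTE-> : y \notin ~` B by rewrite in_setC negbK; exact/mem_set.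
    by rewrite eq_sym onee_eq0.
  exists n => //=; rewrite /f patchE; case: ifP => // _.
  by rewrite eq_sym onee_eq0.
move=> n; apply: integral1_negligible.
- exact: prob_kernel.
- apply/(measurable_restrictT _ _).1 => //; apply: measurable_funTS.
  exact: measurable_cylinder_prob.
- move=> y; rewrite erestrict_ge0/=; last by move=> z _; exact: cylinder_prob_ge0.
  by rewrite /f patchE; case: ifP => // _; exact: cylinder_prob_le1.
- by rewrite -integral_mkcond; exact: (H n.+1).
Qed.

Lemma path_law_step0 mu n A C : measurable A -> measurable C ->
  (forall x, A x -> kappa x C = 0) ->
  path_law kappa mu [set w | A (w n) /\ C (w n.+1)] = 0.
Proof.
move=> mA mC AC.
(* Constraining only times n and n+1 turns the event into a cylinder. *)
pose D i := if i == n then A else if i == n.+1 then C else setT.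
have mD i : measurable (D i) by rewrite /D; case: eqP => // _; case: eqP.
rewrite (_ : [set w | _] = [set w : paths S | forall i, (i <= n.+1)%N -> D i (w i)]).
  rewrite path_lawP// integral0_eq// => x Dx; apply: cylinder_prob_eq0 => //.
  by move=> y; rewrite /D eqxx eqn_leq ltnn eqxx; exact: AC.
apply/seteqP; split=> w /=.
  move=> [Aw Cw] i _; rewrite /D.
  by case: eqP => [->//|_]; case: eqP => [->|].
move=> H; split.
  by have := H n (leqnSn n); rewrite /D eqxx.
by have := H n.+1 (leqnn _); rewrite /D eqn_leq ltnn eqxx.
Qed.

Lemma negligible_exit_avoid_set B mu : measurable B ->
  (path_law kappa mu).-negligible [set w | exists i j, [/\ (i <= j)%N,
     avoid_set kappa B (w i) & ~ avoid_set kappa B (w j)]].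
Proof.
move=> mB; have mN := measurable_avoid_set mB.
pose E i := [set w : paths S |
  avoid_set kappa B (w i) /\ (~` avoid_set kappa B) (w i.+1)].
(* A path inside the avoid-set at time i and outside it at a later time leaves it in a single step
   somewhere in between, so countably many one-step exits cover the event. *)
suff : forall i, (path_law kappa mu).-negligible (E i).
  move/negligible_bigcup; apply: negligibleS => w /= [i [j [ij Ni Nj]]].
  apply: contrapT => H; apply: Nj.
  rewrite -(subnKC ij); elim: (j - i)%N => [|k IH]; first by rewrite addn0.
  by rewrite addnS; apply: contrapT => ?; apply: H; exists (i + k)%N.
move=> i; apply/negligibleP.
  apply: measurableI; apply: measurable_coordinate_set => //.
  exact: measurableC.
by apply: path_law_step0 => // [|x]; [exact: measurableC|exact: kernel_avoid_setC].
Qed.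

End avoid_set.

(** * The Markov property at time one *)

Section markov_property.
Context d (S : measurableType d) (R : realType) (kappa : R.-pker S ~> S).

Section next_law.
Variable mu : probability S R.

(* [mkcomp] composes parameterized kernels, hence the dummy parameter in [unit]. *)
Let initial_kernel : R.-sfker unit ~> S :=
  kprobability (@measurable_cst _ _ _ _ setT (mu : pprobability S R)).

Let next_kernel : R.-sfker (unit * S)%type ~> S :=
  kernel.kernel_snd kappa.

(** The law of the state s_1 when s_0 has law [mu]. *)
Definition next_law : set S -> \bar R :=
  mkcomp initial_kernel next_kernel tt.

Let next_law0 : next_law set0 = 0. Proof. exact: measure0. Qed.

Let next_law_ge0 A : 0 <= next_law A. Proof. exact: measure_ge0. Qed.

Let next_law_sigma_additive : semi_sigma_additive next_law.
Proof. exact: measure_semi_sigma_additive. Qed.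

HB.instance Definition _ := isMeasure.Build _ _ _ next_law
  next_law0 next_law_ge0 next_law_sigma_additive.

Let next_lawT : next_law setT = 1.
Proof.
rewrite /next_law /= /kcomp (eq_integral (cst 1)) => [|x _].
  by rewrite integral_cst//= probability_setT mule1.
exact: prob_kernel.
Qed.

HB.instance Definition _ := Measure_isProbability.Build _ _ _ next_law next_lawT.

Lemma integral_next_law (f : S -> \bar R) :
  (forall x, 0 <= f x) -> measurable_fun setT f ->
  \int[next_law]_y f y = \int[mu]_x \int[kappa x]_y f y.
Proof. by move=> f0 mf; exact: integral_kcomp. Qed.

End next_law.

Definition path_shift (w : paths S) : paths S := fun i => w i.+1.

Lemma measurable_path_shift : measurable_fun setT path_shift.
Proof.
by apply: measurable_to_paths => i; exact: measurable_coordinate.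
Qed.

HB.instance Definition _ :=
  isMeasurableFun.Build _ _ _ _ path_shift measurable_path_shift.

(** The image of the path law under the shift has the finite-dimensional distributions of the chain
    started from [next_law mu], and these determine the law. *)
Lemma path_law_shift (mu : probability S R) (A : set (paths S)) : measurable A ->
  path_law kappa mu (path_shift @^-1` A) = path_law kappa (next_law mu) A.
Proof.
move=> mA.
apply: (path_law_unique (P := distribution (path_law kappa mu) path_shift)
  _ (path_lawP kappa (next_law mu)) mA) => n D mD.
(* Time 0 is left free, so the outermost integral is over the whole space and, with the first kernel
   step, becomes an integral against [next_law mu]. *)
pose D' i := if i is j.+1 then D j else setT.
have mD' i : measurable (D' i) by case: i => [|i]/=.
transitivity (path_law kappa mu [set w | forall i, (i <= n.+1)%N -> D' i (w i)]).
  congr (path_law kappa mu _); apply/seteqP; split=> w H i.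
    by case: i => // i; exact: H.
  exact: (H i.+1).
rewrite path_lawP// [RHS]integral_mkcond integral_next_law.
- by apply: eq_integral => x _; rewrite -integral_mkcond.
- by move=> x; apply: erestrict_ge0 => y _; exact: cylinder_prob_ge0.
- apply/(measurable_restrictT _ _).1 => //; apply: measurable_funTS.
  exact: measurable_cylinder_prob.
Qed.

Lemma eventually_fromS p (B : set S) :
  eventually_from p.+1 B = path_shift @^-1` eventually_from p B.
Proof.
apply/seteqP; split=> w [i pi Bi]; last by exists i.+1.
by case: i pi Bi => // i pi Bi; exists i.
Qed.

End markov_property.

(** * Implications between decisiveness and fairness for one target set *)

Section decisiveness.
Context d (S : measurableType d) (R : realType) (kappa : R.-pker S ~> S).
Variables (B : set S) (mB : measurable B).
Implicit Types mu : probability S R.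

Let mN := measurable_avoid_set kappa mB.

Lemma measurable_infinitely_often (C : set S) : measurable C ->
  measurable (infinitely_often C).
Proof.
move=> mC; rewrite infinitely_oftenE.
by apply: bigcap_measurable => [|p _]; [exists 0%N|exact: measurable_eventually_from].
Qed.

Let measurable_strong :
  measurable (infinitely_often B `|` Defs.eventually (avoid_set kappa B)).
Proof.
by apply: measurableU;
  [exact: measurable_infinitely_often|exact: measurable_eventually].
Qed.

Let measurable_persistent p :
  measurable (eventually_from p B `|` eventually_from p (avoid_set kappa B)).
Proof. by apply: measurableU; exact: measurable_eventually_from. Qed.

Lemma strongly_decisive_persistently mu :
  strongly_decisive_from kappa B mu -> persistently_decisive_from kappa B mu.
Proof.
move=> /(probability1P _ measurable_strong) H p.
apply/(probability1P _ (measurable_persistent p)).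
apply: negligibleS (negligibleU H (negligible_exit_avoid_set kappa mu mB)).
rewrite setCU => w [nB nN].
have [[i Ni]|nFN] := pselect (Defs.eventually (avoid_set kappa B) w).
  (* The path is in the avoid-set at time i but at no time from p on, so it has left it by time
     max(p, i). *)
  right; exists i, (maxn p i); split=> //; first exact: leq_maxr.
  by move=> Np; apply: nN; exists (maxn p i) => //; exact: leq_maxl.
left; case=> //; rewrite infinitely_oftenE => /(_ p Logic.I); exact: nB.
Qed.

Lemma persistently_decisive_strongly mu :
  persistently_decisive_from kappa B mu -> strongly_decisive_from kappa B mu.
Proof.
move=> H; apply/(probability1P _ measurable_strong).
have /negligible_bigcup : forall p, (path_law kappa mu).-negligible
    (~` (eventually_from p B `|` eventually_from p (avoid_set kappa B))).
  by move=> p; apply/(probability1P _ (measurable_persistent p)); exact: H.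
(* If [B] is visited only finitely often, it is not visited from some p on; with no visit to the
   avoid-set either, the persistent event for this p fails. *)
apply: negligibleS; rewrite setCU infinitely_oftenE setC_bigcap.
move=> w [[p _ nB] nN]; exists p => //; rewrite setCU; split=> // -[i _ Ni].
by apply: nN; exists i.
Qed.

Lemma persistently_decisive_decisive mu :
  persistently_decisive_from kappa B mu -> decisive_from kappa B mu.
Proof. by move=> /(_ 0%N); rewrite !eventually_from0. Qed.

(** Shifting turns the event for p+1 under [mu] into the event for p under [next_law mu]; hence the
    induction on p ranges over all initial laws. *)
Lemma decisive_persistently :
  (forall mu, decisive_from kappa B mu) ->
  forall mu, persistently_decisive_from kappa B mu.
Proof.
move=> H mu p; elim: p mu => [|p IH] mu.
  by rewrite !eventually_from0; exact: H.
by rewrite !eventually_fromS -preimage_setU path_law_shift.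
Qed.

Lemma pre_prob_avoid_set B' x : pre_prob kappa B B' -> B' x ->
  ~ avoid_set kappa B x.
Proof.
move=> [mB' H] B'x Nx.
have dx1 : \d_x B' = 1 :> \bar R by rewrite diracE mem_set.
(* The event of positive probability is contained in F B, which has probability 0 from [x]. *)
have := H (dirac x) dx1; rewrite ltNge => /negP; apply; rewrite -Nx; apply: le_measure.
- by rewrite inE; apply: measurableI; exact: measurable_coordinate_set.
- by rewrite inE; exact: measurable_eventually.
- by move=> w [_ Bw]; exists 1%N.
Qed.

Lemma strongly_decisive_fair mu :
  strongly_decisive_from kappa B mu -> fair_from kappa B mu.
Proof.
move=> /(probability1P _ measurable_strong) H B' preB' P0.
have [mB' _] := preB'.
have mGB := measurable_infinitely_often mB.
have mGB' := measurable_infinitely_often mB'.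
set P := path_law kappa mu in H P0 *.
(* Almost surely G F B' implies G F B, so the conditional probability is a quotient of equal
   numbers. *)
have D0 : P (infinitely_often B' `\` infinitely_often B) = 0.
  apply: measure_negligible; first exact: measurableD.
  apply: negligibleS (negligibleU H (negligible_exit_avoid_set kappa mu mB)).
  move=> w [B'w nBw].
  have [[i Ni]|nFN] := pselect (Defs.eventually (avoid_set kappa B) w); last first.
    by left; case.
  (* A visit to [B'] at or after time i happens outside the avoid-set, so the path has left it: a
     null event. *)
  right; move: B'w; rewrite infinitely_oftenE => /(_ i Logic.I)[j ij B'j].
  by exists i, j; split=> //; exact: pre_prob_avoid_set B'j.
rewrite /cond_prob.
suff -> : P (infinitely_often B `&` infinitely_often B') = P (infinitely_often B').
  apply: divff; rewrite gt_eqF// fine_gt0// P0/=.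
  by rewrite (le_lt_trans (probability_le1 _ mGB'))// ltry.
rewrite setIC; transitivity (P (infinitely_often B' `\` infinitely_often B) +
    P (infinitely_often B' `&` infinitely_often B)); first by rewrite D0 add0e.
exact/esym/measureDI.
Qed.

End decisiveness.

Theorem proposition23 (d : measure_display) (S : measurableType d)
    (R : realType) (kappa : R.-pker S ~> S) (BB : set (set S))
    (mu : probability S R) (hBB : BB `<=` measurable) :
  ((wrt_from (strongly_decisive_from kappa) BB mu <->
      wrt_from (persistently_decisive_from kappa) BB mu) /\
   (wrt_from (strongly_decisive_from kappa) BB mu ->
      wrt_from (decisive_from kappa) BB mu /\
      wrt_from (fair_from kappa) BB mu))
  /\
  ((wrt (decisive_from kappa) BB <-> wrt (strongly_decisive_from kappa) BB) /\
   (wrt (strongly_decisive_from kappa) BB <->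
      wrt (persistently_decisive_from kappa) BB) /\
   (wrt (decisive_from kappa) BB -> wrt (fair_from kappa) BB) /\
   (wrt (strongly_decisive_from kappa) BB -> wrt (fair_from kappa) BB) /\
   (wrt (persistently_decisive_from kappa) BB -> wrt (fair_from kappa) BB)).
Proof.
have strongP nu : wrt_from (strongly_decisive_from kappa) BB nu <->
    wrt_from (persistently_decisive_from kappa) BB nu.
  split=> H B BBB.
    exact: strongly_decisive_persistently (hBB _ BBB) _ (H _ BBB).
  exact: persistently_decisive_strongly (hBB _ BBB) _ (H _ BBB).
have strong_fair : wrt (strongly_decisive_from kappa) BB ->
    wrt (fair_from kappa) BB.
  by move=> H B BBB nu; apply: strongly_decisive_fair; [exact: hBB|exact: H].
have strong_persistent : wrt (strongly_decisive_from kappa) BB <->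
    wrt (persistently_decisive_from kappa) BB.
  by split=> H B BBB nu; [apply: ((strongP nu).1 _ B BBB)|
    apply: ((strongP nu).2 _ B BBB)] => C BBC; exact: H.
have decisive_strong : wrt (decisive_from kappa) BB <->
    wrt (strongly_decisive_from kappa) BB.
  split=> H B BBB nu.
    (* The way from decisive to strongly decisive passes through persistence, which uses
       decisiveness from every initial law. *)
    apply: persistently_decisive_strongly; first exact: hBB.
    by apply: decisive_persistently; [exact: hBB|exact: H].
  apply: persistently_decisive_decisive.
  by apply: strongly_decisive_persistently; [exact: hBB|exact: H].
split; first split => //.
  move=> H; split=> B BBB.
    exact: persistently_decisive_decisive ((strongP mu).1 H B BBB).
  by apply: strongly_decisive_fair; [exact: hBB|exact: H].
split=> //; split=> //; split; first by move/decisive_strong.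
by split=> // /strong_persistent.
Qed.
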